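(* Let $G$ be a compactly covered locally compact topologically quasihamiltonian group, let $\phi : G\to G$ be a continuous endomorphism, let $H$ be a closed normal subgroup of $G$ with $\phi(H)=H$ and $\ker\phi\leq H$, and let $\bar\phi : G/H\to G/H$ be the induced map. Then $$h_{alg}(\phi)=h_{alg}(\phi\restriction_H)+h_{alg}(\bar\phi).$$
   Context: All topological groups are Hausdorff. A topological group is compactly covered if each of its elements lies in a compact subgroup. A closed subgroup $N$ of a topological group $G$ is topologically quasinormal if $\overline{NL}=\overline{LN}$ for every closed subgroup $L$ of $G$; $G$ is topologically quasihamiltonian if every closed subgroup of $G$ is topologically quasinormal. Algebraic entropy: let $G$ be a locally compact group with right Haar measure $\mu$ and $\phi$ a continuous endomorphism of $G$. For $U\subseteq G$ and $n\geq 1$ put $T_n(\phi,U)=U\cdot\phi(U)\cdots\phi^{n-1}(U)$. For $U$ a compact neighborhood of $e_G$ put $H_{alg}(\phi,U)=\limsup_{n\to\infty}\frac{\log\mu(T_n(\phi,U))}{n}$, and let $h_{alg}(\phi)\in[0,\infty]$ be the supremum of $H_{alg}(\phi,U)$ over all compact neighborhoods $U$ of $e_G$. The entropies of $\phi\restriction_H : H\to H$ and of $\bar\phi : G/H\to G/H$, $\bar\phi(gH)=\phi(g)H$, are computed in the locally compact groups $H$ and $G/H$. *)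

(* Defs.v *)
From HB Require Import structures.
From mathcomp Require Import all_boot all_order all_algebra.
From mathcomp Require Import all_classical all_reals all_analysis.

Set Implicit Arguments.
Unset Strict Implicit.
Unset Printing Implicit Defensive.

Import Order.TTheory GRing.Theory Num.Theory.
Local Open Scope classical_set_scope.
Local Open Scope group_scope.
Local Open Scope quotient_scope.

(** The Hausdorff axiom is not part of [topologicalGroupType]. *)

HB.structure Definition PreTopologicalGroup :=
  {G of Topological G & Group G}.

HB.mixin Record PreTopologicalGroup_isTopologicalGroup G
    of PreTopologicalGroup G := {
  mulg_continuous : continuous (fun x : G * G => x.1 * x.2) ;
  invg_continuous : continuous (fun x : G => x^-1)
}.

#[short(type="topologicalGroupType")]
HB.structure Definition TopologicalGroup :=
  {G of PreTopologicalGroup G & PreTopologicalGroup_isTopologicalGroup G}.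

Definition mulset (G : groupType) (A B : set G) : set G :=
  [set x * y | x in A & y in B].

Definition is_subgroup (G : groupType) (H : set G) : Prop :=
  [/\ H 1, forall x y, H x -> H y -> H (x * y) & forall x, H x -> H x^-1].

Definition is_normal_subgroup (G : groupType) (H : set G) : Prop :=
  is_subgroup H /\ forall x g, H x -> H (x ^ g).

Section topological_group_properties.
Variable G : topologicalGroupType.

Definition compactly_covered : Prop :=
  forall x : G, exists K : set G, [/\ is_subgroup K, compact K & K x].

Definition topologically_quasinormal (N : set G) : Prop :=
  [/\ is_subgroup N, closed N &
    forall L : set G, is_subgroup L -> closed L ->
      closure (mulset N L) = closure (mulset L N)].

Definition topologically_quasihamiltonian : Prop :=
  forall N : set G, is_subgroup N -> closed N -> topologically_quasinormal N.

End topological_group_properties.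

Definition subgroup_of (G : groupType) (H : set G) (sgH : is_subgroup H) : Type
  := set_type H.

Section subgroup_structure.
Variables (G : topologicalGroupType) (H : set G) (sgH : is_subgroup H).

HB.instance Definition _ := Topological.on (subgroup_of sgH).
HB.instance Definition _ := SubChoice.on (subgroup_of sgH).

Lemma is_subgroup_closed : group_closed (mem H).
Proof.
case: sgH => H1 HM HV; split; first exact: mem_set.
by move=> x y /set_mem Hx /set_mem Hy; apply/mem_set/HM => //; exact: HV.
Qed.

HB.instance Definition _ :=
  SubChoice_isSubGroup.Build G (mem H) (subgroup_of sgH)
    is_subgroup_closed.

End subgroup_structure.
Section subgroup_topology.
Variables (G : topologicalGroupType) (H : set G) (sgH : is_subgroup H).
Local Notation K := (subgroup_of sgH).

Lemma subgroup_val_continuous : continuous (val : K -> G).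
Proof. exact: (@initial_continuous _ _ (val : set_type H -> G)). Qed.

Lemma continuous_to_subgroup (Z : topologicalType) (f : Z -> K) :
  continuous ((val : K -> G) \o f) -> continuous f.
Proof. exact: (@continuous_comp_initial _ _ _ (val : set_type H -> G)). Qed.

Lemma subgroup_mul_continuous : continuous (fun x : K * K => x.1 * x.2).
Proof.
apply: continuous_to_subgroup => z.
have -> : (val : K -> G) \o (fun x : K * K => x.1 * x.2) =
    (fun x : G * G => x.1 * x.2) \o (fun x : K * K => (val x.1, val x.2)) by [].
apply: continuous_comp; last exact: mulg_continuous.
apply: cvg_pair; apply: continuous_comp; [exact: cvg_fst|..|exact: cvg_snd|];
  exact: subgroup_val_continuous.
Qed.

Lemma subgroup_inv_continuous : continuous (fun x : K => x^-1).
Proof.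
apply: continuous_to_subgroup => z.
have -> : (val : K -> G) \o (fun x : K => x^-1) =
    (fun x : G => x^-1) \o (val : K -> G) by [].
apply: continuous_comp; first exact: subgroup_val_continuous.
exact: invg_continuous.
Qed.

HB.instance Definition _ := PreTopologicalGroup_isTopologicalGroup.Build K
  subgroup_mul_continuous subgroup_inv_continuous.

End subgroup_topology.

Section coset_relation.
Variables (G : groupType) (H : set G) (nH : is_normal_subgroup H).

Definition coset_rel : rel G := fun x y => (x^-1 * y) \in H.

Lemma coset_rel_refl : reflexive coset_rel.
Proof. by move=> x; apply/mem_set; rewrite mulVg; case: nH => -[]. Qed.

Lemma coset_rel_sym : symmetric coset_rel.
Proof.
have [[_ _ HV] _] := nH.
suff sub x y : coset_rel x y -> coset_rel y x by move=> x y; apply/idP/idP => /sub.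
by move=> /set_mem/HV Hxy; apply/mem_set; move: Hxy; rewrite invgM invgK.
Qed.

Lemma coset_rel_trans : transitive coset_rel.
Proof.
have [[_ HM _] _] := nH => y x z /set_mem Hxy /set_mem Hyz; apply/mem_set.
by have := HM _ _ Hxy Hyz; rewrite -mulgA mulVKg.
Qed.

Canonical coset_equiv :=
  EquivRel coset_rel coset_rel_refl coset_rel_sym coset_rel_trans.

End coset_relation.

Definition quotient_by (G : groupType) (H : set G) (nH : is_normal_subgroup H)
  : Type := quotient_topology {eq_quot (coset_equiv nH)}.

Section quotient_structure.
Variables (G : topologicalGroupType) (H : set G) (nH : is_normal_subgroup H).
Local Notation Q := (quotient_by nH).

HB.instance Definition _ := Quotient.on Q.
HB.instance Definition _ := Topological.on Q.

Definition coset_pi (x : G) : Q := \pi_({eq_quot (coset_equiv nH)}) x.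

Definition coset_repr (q : Q) : G :=
  repr (q : {eq_quot (coset_equiv nH)}).

Lemma coset_reprK : cancel coset_repr coset_pi.
Proof. exact: (@reprK _ {eq_quot (coset_equiv nH)}). Qed.

Lemma coset_piP (x y : G) : coset_pi x = coset_pi y <-> H (x^-1 * y).
Proof.
split=> [/(eqmodP (coset_equiv nH))/set_mem //|Hxy].
by apply/(eqmodP (coset_equiv nH))/mem_set.
Qed.

Definition quotient_one : Q := coset_pi 1.
Definition quotient_mul (p q : Q) : Q :=
  coset_pi (coset_repr p * coset_repr q).
Definition quotient_inv (p : Q) : Q := coset_pi (coset_repr p)^-1.

Lemma coset_repr_pi (x : G) : H (x^-1 * coset_repr (coset_pi x)).
Proof. by apply/coset_piP; rewrite coset_reprK. Qed.

Lemma quotient_mulE (x y : G) :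
  quotient_mul (coset_pi x) (coset_pi y) = coset_pi (x * y).
Proof.
have [[_ HM _] HJ] := nH.
apply/esym/coset_piP.
have -> : (x * y)^-1 * (coset_repr (coset_pi x) * coset_repr (coset_pi y)) =
    (x^-1 * coset_repr (coset_pi x)) ^ y * (y^-1 * coset_repr (coset_pi y)).
  by rewrite /conjg invgM -!mulgA mulVKg.
by apply: HM; [apply: HJ|]; exact: coset_repr_pi.
Qed.

Lemma quotient_invE (x : G) : quotient_inv (coset_pi x) = coset_pi x^-1.
Proof.
have [[_ HM HV] HJ] := nH.
apply/coset_piP; rewrite invgK.
have := HJ _ x^-1 (coset_repr_pi x).
by rewrite /conjg invgK -mulgA mulVKg.
Qed.

Lemma quotient_mulA : associative quotient_mul.
Proof.
move=> p q r; rewrite -[p]coset_reprK -[q]coset_reprK -[r]coset_reprK.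
by rewrite !quotient_mulE mulgA.
Qed.

Lemma quotient_mul1 : left_id quotient_one quotient_mul.
Proof. by move=> p; rewrite -[p]coset_reprK quotient_mulE mul1g. Qed.

Lemma quotient_mulr1 : right_id quotient_one quotient_mul.
Proof. by move=> p; rewrite -[p]coset_reprK quotient_mulE mulg1. Qed.

Lemma quotient_mulV : left_inverse quotient_one quotient_inv quotient_mul.
Proof.
by move=> p; rewrite -[p]coset_reprK quotient_invE quotient_mulE mulVg.
Qed.

Lemma quotient_mulrV : right_inverse quotient_one quotient_inv quotient_mul.
Proof.
by move=> p; rewrite -[p]coset_reprK quotient_invE quotient_mulE mulgV.
Qed.

HB.instance Definition _ := isGroup.Build Q quotient_mulA quotient_mul1
  quotient_mulr1 quotient_mulV quotient_mulrV.

Lemma coset_piM (x y : G) : coset_pi (x * y) = coset_pi x * coset_pi y.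
Proof. by rewrite -quotient_mulE. Qed.

Lemma coset_piV (x : G) : coset_pi x^-1 = (coset_pi x)^-1.
Proof. by rewrite -quotient_invE. Qed.

Lemma coset_pi_continuous : continuous coset_pi.
Proof. exact: (@pi_continuous G {eq_quot (coset_equiv nH)}). Qed.

Lemma continuous_from_quotient (Z : topologicalType) (f : Q -> Z) :
  continuous (f \o coset_pi) -> continuous f.
Proof. by move/(@quotient_continuous G {eq_quot (coset_equiv nH)} Z). Qed.

Lemma mulgr_continuous (g : G) : continuous (fun x : G => x * g).
Proof.
move=> x; apply: (@continuous_comp _ _ _ (fun x => (x, g))
  (fun x : G * G => x.1 * x.2)); last exact: mulg_continuous.
by apply: cvg_pair => /=; [exact: cvg_id|exact: cvg_cst].
Qed.

Lemma coset_pi_open (A : set G) : open A -> open (coset_pi @` A).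
Proof.
move=> oA; rewrite /open /= /quotient_open.
suff -> : \pi_(quotient_topology {eq_quot (coset_equiv nH)})
    @^-1` (coset_pi @` A) = \bigcup_(h in H) ((fun x : G => x * h) @^-1` A).
  by apply: bigcup_open => h _; apply: open_comp => // x _; exact: mulgr_continuous.
have [[_ HM HV] HJ] := nH.
apply/seteqP; split=> [x [a Aa] /esym/coset_piP Hxa|x [h Hh /= Axh]].
  by exists (x^-1 * a) => //=; rewrite mulVKg.
exists (x * h) => //; apply/coset_piP.
by rewrite invgM -mulgA mulVg mulg1; exact: HV.
Qed.

Lemma quotient_mul_continuous : continuous (fun x : Q * Q => x.1 * x.2).
Proof.
move=> [p q] U /=; rewrite -[p]coset_reprK -[q]coset_reprK.
set x := coset_repr p; set y := coset_repr q; rewrite -coset_piM.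
move=> /coset_pi_continuous/(@mulg_continuous G (x, y)) [[V W] /= [Vx Wy] VWU].
exists (coset_pi @` V, coset_pi @` W) => /=.
  move: Vx Wy; rewrite !nbhsE => -[V' [oV' V'x] V'V] [W' [oW' W'y] W'W].
  split; [exists (coset_pi @` V')|exists (coset_pi @` W')].
  - by split; [exact: coset_pi_open|exists x].
  - exact: image_subset.
  - by split; [exact: coset_pi_open|exists y].
  - exact: image_subset.
move=> [_ _] /= [[v Vv <-] [w Ww <-]]; rewrite -coset_piM.
exact: (VWU (v, w)).
Qed.

Lemma quotient_inv_continuous : continuous (fun x : Q => x^-1).
Proof.
apply: continuous_from_quotient => x.
have -> : (fun x : Q => x^-1) \o coset_pi = coset_pi \o (fun x : G => x^-1).
  by apply/funext => y /=; rewrite coset_piV.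
apply: continuous_comp; first exact: invg_continuous.
exact: coset_pi_continuous.
Qed.

HB.instance Definition _ := PreTopologicalGroup_isTopologicalGroup.Build Q
  quotient_mul_continuous quotient_inv_continuous.

End quotient_structure.

Definition restrict_endo (G : groupType) (H : set G) (sgH : is_subgroup H)
    (phi : G -> G) (invH : set_fun H H phi) (x : subgroup_of sgH) :
  subgroup_of sgH := exist _ (phi (val x)) (mem_set (invH _ (set_mem (valP x)))).

(** Meaningful when [phi] maps [H] to [H], see [quotient_endoE]. *)
Definition quotient_endo (G : topologicalGroupType) (H : set G)
    (nH : is_normal_subgroup H) (phi : G -> G) (q : quotient_by nH) :
  quotient_by nH := coset_pi nH (phi (coset_repr q)).

Lemma quotient_endoE (G : topologicalGroupType) (H : set G)
    (nH : is_normal_subgroup H) (phi : {multiplicative G -> G})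
    (invH : set_fun H H phi) (g : G) :
  quotient_endo phi (coset_pi nH g) = coset_pi nH (phi g).
Proof.
apply/esym/coset_piP.
have -> : (phi g)^-1 = phi g^-1.
  apply: (@mulIg _ (phi g)).
  have phi1 : phi 1 = 1 by apply: (@mulIg _ (phi 1)); rewrite -gmulfM !mul1g.
  by rewrite -gmulfM !mulVg phi1.
by rewrite -gmulfM; apply: invH; exact: coset_repr_pi.
Qed.

Lemma image_eq_set_fun (T : Type) (H : set T) (phi : T -> T) :
  phi @` H = H -> set_fun H H phi.
Proof. by move=> HE x Hx; rewrite -HE; exists x. Qed.

(** [pointed_group] supplies the base point (the identity) that
    [g_sigma_algebraType] requires. *)

Definition pointed_group (G : Type) : Type := G.
HB.instance Definition _ (G : topologicalGroupType) :=
  Choice.on (pointed_group G).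
HB.instance Definition _ (G : topologicalGroupType) :=
  isPointed.Build (pointed_group G) (1 : G).

Notation borel G :=
  (g_sigma_algebraType (@open G : set (set (pointed_group G)))).

Section haar_measure.
Local Open Scope ereal_scope.
Variables (R : realType) (G : topologicalGroupType).

Definition right_haar_measure (mu : {measure set (borel G) -> \bar R}%R) : Prop :=
  (* nonzero, right-invariant, and Radon: finite on compact sets, outer regular
     on Borel sets, inner regular on open sets *)
  [/\ mu [set: G] != 0,
      forall (A : set (borel G)) (g : G), measurable A ->
        mu [set (x * g)%g | x in (A : set G)] = mu A,
      forall K : set G, compact K -> mu K < +oo,
      forall A : set (borel G), measurable A ->
        mu A = ereal_inf [set mu U | U in [set U : set G | open U /\ A `<=` U]]
    & forall U : set G, open U ->
        mu U = ereal_sup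
          [set mu K | K in [set K : set G | compact K /\ K `<=` U]]].

End haar_measure.

Section entropy.
Variables (R : realType) (G : topologicalGroupType).

(** U phi(U) ... phi^(n-1)(U) for n >= 1, and {1} for n = 0. *)
Fixpoint trajectory (phi : G -> G) (U : set G) (n : nat) : set G :=
  if n is m.+1 then mulset (trajectory phi U m) (iter m phi @` U)
  else [set 1].

Local Open Scope ereal_scope.
Variable mu : {measure set (borel G) -> \bar R}%R.

(* The index is shifted so that the sequence starts at n = 1. *)
Definition H_alg (phi : G -> G) (U : set G) : \bar R :=
  limn_esup (fun n => lne (mu (trajectory phi U n.+1)) * (n.+1%:R^-1)%:E).

Definition h_alg (phi : G -> G) : \bar R :=
  ereal_sup [set H_alg phi U | U in [set U : set G | compact U /\ nbhs 1%g U]].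

End entropy.

(* Main.v *)
Require Import Defs.
From HB Require Import structures.
From mathcomp Require Import all_boot all_order all_algebra finmap.
From mathcomp Require Import all_classical all_reals all_analysis.
From mathcomp Require Import ring.

(** Two consequences of the hypotheses carry the proof. Compact subgroups [A]
    and [B] satisfy AB = BA, since AB and BA are already closed
    ([quasihamiltonian_permute]); and every compact set lies in a compact open
    subgroup ([elliptic_of_compactly_covered]). Both properties pass to H and to
    G/H, so each of the three entropies is a supremum over compact open
    subgroups.

    Let U be a compact open subgroup of a group with these properties. The
    trajectories T_n = U phi(U) ... phi^(n-1)(U) are compact subgroups, and
    T_(n+1) = T_n phi^n(U) gives [T_(n+1) : T_n] = [U : U /\ phi^(-n)(T_n)].
    The subgroups phi^(-n)(T_n) increase to an open subgroup W
    ([cotrajectory]); by compactness of U these indices are eventually equal to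
    [U : U /\ W], and the entropy along U is the logarithm of that integer,
    a formula without limits ([H_alg_compact_open]). Moreover V = WU is a
    subgroup, W = phi^(-1)(V), and [U : U /\ W] = [V : W].

    Write pi for the projection onto G/H. Both inequalities rest on
    [A : B] = [pi A : pi B] [A /\ H : B /\ H] ([has_index_mul]).

    Upper bound: apply this to W <= V. Since phi(H) = H, the subgroup pi W is
    the cotrajectory of pi U ([cotrajectory_quotient]), so the first factor is
    the one whose logarithm is the entropy of the induced map along pi U. The
    second factor is [N : psi^(-1)(N)] for N = V /\ H and psi the restriction
    of phi to H. Such an index is at most the exponential of the entropy of psi:
    a compact open subgroup of N that contains coset representatives already
    realizes it ([ln_preimage_index_le_h_alg]).

    Lower bound: apply it to T_n <= T_(n+1) for large n. The first factor is
    the growth ratio of the trajectories of pi U in G/H, so the second factor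
    does not depend on n either; it is the growth ratio of T_n /\ H, a set that
    contains the trajectory of U /\ H in H, hence it is at least the growth
    ratio of the latter ([ln_index_add_le]). Finally a single U can be chosen
    such that U /\ H and pi U are as large as desired. *)

Set Implicit Arguments.
Unset Strict Implicit.
Unset Printing Implicit Defensive.

Import Order.TTheory GRing.Theory Num.Theory.
Import numFieldNormedType.Exports.
Local Open Scope classical_set_scope.
Local Open Scope group_scope.

(** * Subgroups and products of subsets *)

Section subgroups.
Variable G : groupType.
Implicit Types A B H : set G.

Lemma subgroup_div A x y : is_subgroup A -> A x -> A y -> A (x * y^-1).
Proof. by move=> [_ AM AV] Ax Ay; apply: AM => //; exact: AV. Qed.

Lemma subgroup_mulr A x y : is_subgroup A -> A y -> A (x * y) <-> A x.
Proof.
move=> sA Ay; split=> [Axy|Ax]; last by case: sA => _ AM _; exact: AM.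
by have := subgroup_div sA Axy Ay; rewrite mulgK.
Qed.

Lemma subgroup_mull A x y : is_subgroup A -> A x -> A (x * y) <-> A y.
Proof.
move=> [_ AM AV] Ax; split=> [Axy|Ay]; last exact: AM.
by have := AM _ _ (AV _ Ax) Axy; rewrite mulKg.
Qed.

Lemma subgroup_mulmr A a b z : is_subgroup A -> A a -> A b ->
  A (a * z * b^-1) <-> A z.
Proof.
move=> sA Aa Ab; have Ab' : A b^-1 by case: sA => _ _; exact.
by split=> [/(subgroup_mulr _ sA Ab')/(subgroup_mull _ sA Aa)|Az] //;
  apply/subgroup_mulr => //; apply/subgroup_mull.
Qed.

Lemma subgroup_inv A x : is_subgroup A -> A x^-1 <-> A x.
Proof. by move=> [_ _ AV]; split=> [/AV|/AV//]; rewrite invgK. Qed.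

Lemma subgroupI A B : is_subgroup A -> is_subgroup B -> is_subgroup (A `&` B).
Proof.
move=> [A1 AM AV] [B1 BM BV]; split=> // [x y [? ?] [? ?]|x [? ?]].
  by split; [exact: AM|exact: BM].
by split; [exact: AV|exact: BV].
Qed.

Lemma subgroup_set1 : is_subgroup [set 1 : G].
Proof.
by split=> // [x y -> ->|x ->]; rewrite ?mulg1 ?invg1.
Qed.

Lemma mulset_subgroup A B : is_subgroup A -> is_subgroup B ->
  mulset A B = mulset B A -> is_subgroup (mulset A B).
Proof.
move=> [A1 AM AV] [B1 BM BV] AB; split.
- by exists 1 => //; exists 1 => //; rewrite mulg1.
- move=> _ _ [a Aa [b Bb <-]] [a' Aa' [b' Bb' <-]].
  have : mulset A B (b * a') by rewrite AB; exists b => //; exists a'.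
  move=> [a'' Aa'' [b'' Bb'' E]].
  exists (a * a''); first exact: AM.
  exists (b'' * b'); first exact: BM.
  by rewrite mulgA -(mulgA a) E !mulgA.
- move=> _ [a Aa [b Bb <-]]; rewrite AB invgM.
  by exists b^-1; [exact: BV|exists a^-1; [exact: AV|]].
Qed.

Lemma sub_mulsetl A B : B 1 -> A `<=` mulset A B.
Proof. by move=> B1 x Ax; exists x => //; exists 1 => //; rewrite mulg1. Qed.

Lemma sub_mulsetr A B : A 1 -> B `<=` mulset A B.
Proof. by move=> A1 x Bx; exists 1 => //; exists x => //; rewrite mul1g. Qed.

Lemma mulsetSS A A' B B' :
  A `<=` A' -> B `<=` B' -> mulset A B `<=` mulset A' B'.
Proof.
by move=> AA BB _ [a /AA Aa [b /BB Bb <-]]; exists a => //; exists b.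
Qed.

End subgroups.

Section morphisms.
Variables (G K : groupType) (f : G -> K).
Hypothesis fM : {morph f : x y / x * y}.

Lemma morph_1 : f 1 = 1.
Proof. by apply: (@mulIg _ (f 1)); rewrite -fM !mul1g. Qed.

Lemma morph_V x : f x^-1 = (f x)^-1.
Proof. by apply: (@mulIg _ (f x)); rewrite -fM !mulVg morph_1. Qed.

Lemma image_subgroup A : is_subgroup A -> is_subgroup (f @` A).
Proof.
move=> [A1 AM AV]; split.
- by exists 1 => //; exact: morph_1.
- move=> _ _ [x Ax <-] [y Ay <-]; exists (x * y); [exact: AM|exact: fM].
- by move=> _ [x Ax <-]; exists x^-1; [exact: AV|exact: morph_V].
Qed.

Lemma preimage_subgroup B : is_subgroup B -> is_subgroup (f @^-1` B).
Proof.
move=> [B1 BM BV]; split=> [|x y|x] /=.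
- by rewrite morph_1.
- by rewrite fM; exact: BM.
- by rewrite morph_V; exact: BV.
Qed.

Lemma image_mulset A B : f @` (mulset A B) = mulset (f @` A) (f @` B).
Proof.
apply/seteqP; split=> [_ [_ [a Aa [b Bb <-]] <-]|].
  by exists (f a); [exists a|exists (f b); [exists b|rewrite fM]].
move=> _ [_ [a Aa <-] [_ [b Bb <-] <-]].
by exists (a * b); [exists a => //; exists b|rewrite fM].
Qed.

End morphisms.

Lemma iter_morph (G : groupType) (f : G -> G) n :
  {morph f : x y / x * y} -> {morph iter n f : x y / x * y}.
Proof. by move=> fM x y; elim: n => //= n ->; rewrite fM. Qed.

(** * The index of a subgroup *)

Section index.

(** The labels [c] identify the right cosets of [B] that meet [A] with
    0, ..., n-1. The set [B] is not assumed to lie in [A]: for subgroups, [n] is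
    the index of the intersection of [A] and [B] in [A], and different [A] can be
    compared with one [B]. *)
Definition has_index (G : groupType) (A B : set G) (n : nat) : Prop :=
  exists2 c : G -> nat, c @` A = `I_n &
    forall x y, A x -> A y -> (c x = c y <-> B (x * y^-1)).

Variable G : groupType.
Implicit Types A B U W : set G.

Lemma has_index_gt0 A B n x : A x -> has_index A B n -> (0 < n)%N.
Proof.
move=> Ax [c cA _]; have : `I_n (c x) by rewrite -cA; exists x.
by case: n {cA}.
Qed.

Lemma has_index_eq A B B' n : is_subgroup A -> A `&` B = A `&` B' ->
  has_index A B n -> has_index A B' n.
Proof.
move=> sA BB' [c cA cP]; exists c => // x y Ax Ay; rewrite cP//.
have Axy := subgroup_div sA Ax Ay.
split=> Bxy.
  by have [] : (A `&` B') (x * y^-1) by rewrite -BB'.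
by have [] : (A `&` B) (x * y^-1) by rewrite BB'.
Qed.

Lemma has_index_le A B B' n m : has_index A B n -> has_index A B' m ->
  B `<=` B' -> (m <= n)%N.
Proof.
move=> [c cA cP] [c' cA' cP'] BB'.
have /choice[r rP] : forall i : 'I_m, exists x, A x /\ c' x = i.
  by move=> i; have [x Ax] : (c' @` A) i; [rewrite cA' /=|exists x].
have cn x : A x -> (c x < n)%N.
  by move=> Ax; have : `I_n (c x) by rewrite -cA; exists x.
pose g (i : 'I_m) := Ordinal (cn _ (rP i).1).
suff /leq_card : injective g by rewrite !card_ord.
move=> i j [gij]; apply: val_inj; rewrite /= -(rP i).2 -(rP j).2.
have [Ai _] := rP i; have [Aj _] := rP j.
by apply/cP' => //; apply: BB'; apply/cP.
Qed.

Lemma has_index_uniq A B n m : has_index A B n -> has_index A B m -> n = m.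
Proof.
move=> n_ m_; apply/eqP; rewrite eqn_leq.
by rewrite (has_index_le m_ n_)// (has_index_le n_ m_).
Qed.

(** The second isomorphism theorem: every right coset of [W] in [mulset W U]
    has a representative in [U]. *)
Lemma has_index_mulset W U n : is_subgroup W ->
  has_index (mulset W U) W n <-> has_index U W n.
Proof.
move=> sW; have [W1 WM WV] := sW.
have U_WU := @sub_mulsetr _ W U W1.
split=> [[c cA cP]|[c cA cP]].
  exists c => [|x y Ux Uy]; last by apply: cP; exact: U_WU.
  rewrite -cA; apply/seteqP; split; first exact: image_subset.
  move=> _ [_ [w Ww [u Uu <-]] <-]; exists u => //.
  apply/cP; [exact: U_WU|by exists w => //; exists u|].
  by rewrite invgM mulgA mulgV mul1g; exact: WV.
have /choice[u uP] : forall x, exists u, mulset W U x -> U u /\ W (x * u^-1).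
  move=> x; have [[w Ww [u Uu <-]]|nx] := pselect (mulset W U x).
    by exists u => _; rewrite mulgK.
  by exists 1.
have cu x : U x -> c (u x) = c x.
  move=> Ux; have [Uu Wu] := uP _ (U_WU _ Ux).
  by apply/esym/cP.
exists (c \o u).
  rewrite -cA; apply/seteqP; split=> [_ [x /uP[Uu _] <-]|_ [x Ux <-]].
    by exists (u x).
  by exists x; [exact: U_WU|exact: cu].
move=> x y /uP[Ux Wx] /uP[Uy Wy] /=; rewrite cP//.
have -> : x * y^-1 = (x * (u x)^-1) * (u x * (u y)^-1) * (y * (u y)^-1)^-1.
  by rewrite invgM invgK !mulgA !mulgVK.
by apply: iff_sym; exact: subgroup_mulmr.
Qed.

Lemma has_index_cover A B F : is_subgroup B -> finite_set F ->
  A `<=` mulset B F -> exists n, has_index A B n.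
Proof.
move=> sB finF AF; have [B1 BM BV] := sB.
(* The finitely many cosets are counted as elements of the power set of G. *)
pose coset x := [set y | B (x * y^-1)].
have cosetP x y : coset x = coset y <-> B (x * y^-1).
  split=> [xy|Bxy]; last first.
    apply/seteqP; split=> z Bz; rewrite /coset /=.
      by have := BM _ _ (BV _ Bxy) Bz; rewrite invgM invgK mulgA mulgVK.
    by have := BM _ _ Bxy Bz; rewrite mulgA mulgVK.
  have : coset y y by rewrite /coset /= mulgV.
  by rewrite -xy.
have /finite_setP[n /card_set_bijP[g [gn ginj gsurj]]] :
    finite_set (coset @` A).
  apply: (@sub_finite_set _ _ (coset @` F)); last exact: finite_image.
  move=> _ [x /AF[b Bb [y Fy <-]] <-]; exists y => //.
  by apply/esym/cosetP; rewrite mulgK.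
exists n, (g \o coset).
  apply/seteqP; split=> [_ [x Ax <-]|i /gsurj[_ [x Ax <-] <-]].
    by apply: gn; exists x.
  by exists x.
move=> x y Ax Ay; rewrite -cosetP /=; split=> [|-> //].
by apply: ginj; rewrite inE; [exists x|exists y].
Qed.

Lemma has_index_transversal A B n : has_index A B n ->
  exists F, [/\ finite_set F, F `<=` A & A `<=` mulset B F].
Proof.
move=> [c cA cP].
have /choice[r rP] : forall i : 'I_n, exists x, A x /\ c x = i.
  by move=> i; have [x Ax] : (c @` A) i; [rewrite cA /=|exists x].
exists (range r); split.
- exact: finite_image.
- by move=> _ [i _ <-]; have [] := rP i.
- move=> x Ax; have cn : (c x < n)%N.
    by have : `I_n (c x) by rewrite -cA; exists x.
  have [Ar cr] := rP (Ordinal cn).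
  exists (x * (r (Ordinal cn))^-1); first by apply/cP.
  by exists (r (Ordinal cn)); [exists (Ordinal cn)|rewrite mulgVK].
Qed.

Lemma has_index_sub A A' B n : is_subgroup B -> has_index A B n -> A' `<=` A ->
  exists m, has_index A' B m.
Proof.
move=> sB /has_index_transversal[F [finF _ AF]] A'A.
exact: has_index_cover sB finF (subset_trans A'A AF).
Qed.

End index.

Lemma has_index_image (G K : groupType) (f : G -> K) A B n :
  {morph f : x y / x * y} ->
  has_index (f @` A) B n -> has_index A (f @^-1` B) n.
Proof.
move=> fM [c cA cP]; exists (c \o f); first by rewrite -cA image_comp.
move=> x y Ax Ay /=; rewrite fM morph_V//.
by apply: cP; [exists x|exists y].
Qed.

(** Multiplicativity of the index in an extension: let [r i] in [A] represent
    the coset of [f @` B] with label [i]. Every [x] in [A] is [b * h * r i] with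
    [b] in [B] and [h] in the kernel of [f], where [i] and the coset of [h] are
    determined by the coset of [x]; the pair of labels is encoded as an integer
    in mixed radix. *)
Lemma has_index_mul (G K : groupType) (f : G -> K) A B p q :
  {morph f : x y / x * y} -> is_subgroup A -> is_subgroup B -> B `<=` A ->
  has_index (f @` A) (f @` B) p -> has_index (A `&` f @^-1` [set 1]) B q ->
  has_index A B (p * q).
Proof.
move=> fM sA sB BA [c cA cP] [d dA dP].
have [A1 AM AV] := sA; have [B1 BM BV] := sB.
have f1 := morph_1 fM; have fV := morph_V fM.
have cn x : A x -> (c (f x) < p)%N.
  move=> Ax; have : `I_p (c (f x)) by rewrite -cA; exists (f x) => //; exists x.
  by [].
have dn x : A x -> f x = 1 -> (d x < q)%N.
  by move=> Ax fx1; have : `I_q (d x) by rewrite -dA; exists x.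
have /choice[r rP] : forall i, exists x, (i < p)%N -> A x /\ c (f x) = i.
  move=> i; have [ip|_] := boolP (i < p)%N; last by exists 1.
  by have [_ [x Ax <-] <-] : (c @` (f @` A)) i; [rewrite cA|exists x].
pose t x := r (c (f x)).
have /choice[h hP] : forall x, exists h, A x ->
    [/\ A h, f h = 1 & B (x * (t x)^-1 * h^-1)].
  move=> x; have [Ax|] := pselect (A x); last by exists 1.
  have [At ct] := rP _ (cn _ Ax).
  have [b Bb fb] : (f @` B) (f (x * (t x)^-1)).
    rewrite fM fV; apply/cP; [by exists x|by exists (t x)|by []].
  exists (b^-1 * (x * (t x)^-1)) => _; split.
  - by apply: AM; [apply/AV/BA|exact: subgroup_div].
  - by rewrite fM fV fb mulVg.
  - by rewrite invgM invgK mulgA mulgV mul1g.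
exists (fun x => c (f x) * q + d (h x))%N.
  apply/seteqP; split=> [_ [x Ax <-]|k /= kpq].
    have [Ah fh _] := hP _ Ax; have := cn _ Ax; have := dn _ Ah fh.
    move=> /= dq cp; apply: (@leq_trans ((c (f x)).+1 * q)); last first.
      by rewrite leq_mul2r cp orbT.
    by rewrite mulSn addnC ltn_add2r.
  have q0 : (0 < q)%N by case: q kpq {dA dn} => //; rewrite muln0.
  have ip : (k %/ q < p)%N by rewrite ltn_divLR.
  have [Ar cr] := rP _ ip.
  have [y [Ay fy1] dy] : (d @` (A `&` f @^-1` [set 1])) (k %% q)%N.
    by rewrite dA /=; exact: ltn_pmod.
  have Ayr : A (y * r (k %/ q)%N) by exact: AM.
  exists (y * r (k %/ q)%N) => //.
  have cyr : c (f (y * r (k %/ q)%N)) = (k %/ q)%N by rewrite fM fy1 mul1g.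
  have [Ah fh Bh] := hP _ Ayr.
  rewrite cyr [RHS](divn_eq k q); congr (_ + _)%N; rewrite -dy.
  apply/dP => //=; apply/subgroup_inv => //.
  by rewrite invgM invgK; move: Bh; rewrite /t cyr mulgK.
move=> x y Ax Ay; have [Ahx fhx Bx] := hP _ Ax; have [Ahy fhy By] := hP _ Ay.
have hxy : t x = t y -> (d (h x) = d (h y) <-> B (x * y^-1)).
  move=> txy; rewrite dP//.
  have -> : x * y^-1 = (x * (t x)^-1 * (h x)^-1) * (h x * (h y)^-1) *
      (y * (t y)^-1 * (h y)^-1)^-1.
    by rewrite txy !invgM !invgK !mulgA !mulgVK.
  by apply: iff_sym; exact: subgroup_mulmr.
have dhx := dn _ Ahx fhx; have dhy := dn _ Ahy fhy.
have q0 : (0 < q)%N by exact: leq_ltn_trans dhx.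
split=> [E|Bxy].
  have E1 : c (f x) = c (f y).
    by have := congr1 (divn^~ q) E; rewrite !divnMDl// !divn_small// !addn0.
  by apply/hxy; [rewrite /t E1|move: E; rewrite E1 => /addnI].
have E1 : c (f x) = c (f y).
  by apply/cP; [exists x|exists y|exists (x * y^-1) => //; rewrite fM fV].
by rewrite E1; congr (_ + _)%N; apply/hxy; rewrite // /t E1.
Qed.

(** * Topological groups with many compact open subgroups *)

(** The identity as base point makes compactness by open covers applicable. *)
HB.instance Definition _ (G : topologicalGroupType) :=
  Topological.on (pointed_group G).

Lemma compact_setI_closed (T : topologicalType) (A B : set T) :
  compact A -> closed B -> compact (A `&` B).
Proof.
move=> kA cB F FF FAB; have [|x [Ax clx]] := kA F FF.
  by apply: filterS FAB; exact: subIsetl.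
exists x; split=> //; split=> //; apply: cB => C nC.
by apply: clx => //; apply: filterS FAB; exact: subIsetr.
Qed.

Section topological_groups.
Variable G : topologicalGroupType.
Implicit Types A B C F U V : set G.

Lemma group_compact_cover A : compact A -> @cover_compact G A.
Proof. by rewrite -[compact]/(@compact (pointed_group G)) compact_cover. Qed.

Lemma mulgl_continuous (g : G) : continuous (fun x : G => g * x).
Proof.
move=> x; apply: (@continuous_comp _ _ _ (fun x => (g, x))
  (fun x : G * G => x.1 * x.2)); last exact: mulg_continuous.
by apply: cvg_pair => /=; [exact: cvg_cst|exact: cvg_id].
Qed.

Lemma open_mulset_set1 A (g : G) : open A -> open (mulset A [set g]).
Proof.
move=> oA; suff -> : mulset A [set g] = (fun x => x * g^-1) @^-1` A.
  by apply: open_comp => // x _; exact: mulgr_continuous.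
apply/seteqP; split=> [_ [a Aa [_ -> <-]]|x Ax] /=; first by rewrite mulgK.
by exists (x * g^-1) => //; exists g => //; rewrite mulgVK.
Qed.

Lemma open_set1_mulset A (g : G) : open A -> open (mulset [set g] A).
Proof.
move=> oA; suff -> : mulset [set g] A = (fun x => g^-1 * x) @^-1` A.
  by apply: open_comp => // x _; exact: mulgl_continuous.
apply/seteqP; split=> [_ [_ -> [a Aa <-]]|x Ax] /=; first by rewrite mulKg.
by exists g => //; exists (g^-1 * x) => //; rewrite mulVKg.
Qed.

Lemma open_mulset A B : open A -> open (mulset A B).
Proof.
move=> oA; suff -> : mulset A B = \bigcup_(b in B) mulset A [set b].
  by apply: bigcup_open => b _; exact: open_mulset_set1.
apply/seteqP; split=> [_ [a Aa [b Bb <-]]|_ [b Bb [a Aa [_ -> <-]]]].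
  by exists b => //; exists a => //; exists b.
by exists a => //; exists b.
Qed.

Lemma open_subgroup_nbhs A : is_subgroup A -> nbhs 1 A -> open A.
Proof.
move=> sA nA; have [A1 AM _] := sA.
suff -> : A = mulset A^° A by apply/open_mulset/open_interior.
apply/seteqP; split; first by apply: sub_mulsetr.
by move=> _ [x /interior_subset Ax [y Ay <-]]; exact: AM.
Qed.

(** The complement of a subgroup is a union of cosets. *)
Lemma open_subgroup_closed A : is_subgroup A -> open A -> closed A.
Proof.
move=> sA oA; rewrite -[A]setCK; apply: open_closedC.
suff -> : ~` A = mulset A (~` A) by exact: open_mulset.
apply/seteqP; split; first by apply: sub_mulsetr; case: sA.
by move=> _ [x Ax [y Ay <-]] /subgroup_mull => /(_ sA Ax).
Qed.

Lemma compact_mulset A B : compact A -> compact B -> compact (mulset A B).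
Proof.
move=> kA kB.
suff -> : mulset A B = (fun x : G * G => x.1 * x.2) @` (A `*` B).
  apply: continuous_compact; last exact: compact_setX.
  by apply: continuous_subspaceT; exact: mulg_continuous.
apply/seteqP; split=> [_ [a Aa [b Bb <-]]|_ [[a b] /= [Aa Bb] <-]].
  by exists (a, b).
by exists a => //; exists b.
Qed.

Lemma compact_image (T : topologicalType) (f : G -> T) A :
  continuous f -> compact A -> compact (f @` A).
Proof.
by move=> cf; apply: continuous_compact; exact: continuous_subspaceT.
Qed.

Lemma compact_finite_translates C V : compact C -> nbhs 1 V ->
  exists2 F, finite_set F & C `<=` mulset F V.
Proof.
move=> kC nV; have [||D _ CD] := @group_compact_cover _ kC G setT
    (fun x => mulset [set x] V^°).
- by move=> x _; exact/open_set1_mulset/open_interior.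
- by move=> x _; exists x => //; exists x => //; exists 1 => //; rewrite mulg1.
exists [set` D]; first exact: finite_fset.
move=> x /CD[y /= Dy [_ -> [v /interior_subset Vv <-]]].
by exists y => //; exists v.
Qed.

Lemma has_index_compact A B : compact A -> is_subgroup B -> open B ->
  exists n, has_index A B n.
Proof.
move=> kA sB oB; have [||D _ AD] := @group_compact_cover _ kA G setT
    (fun x => mulset B [set x]).
- by move=> x _; exact: open_mulset_set1.
- move=> x _; exists x => //; exists 1; first by case: sB.
  by exists x => //; rewrite mul1g.
apply: (@has_index_cover _ A B [set` D] sB); first exact: finite_fset.
by move=> x /AD[y /= Dy [b Bb [_ -> <-]]]; exists b => //; exists y.
Qed.

Definition compact_open_subgroup U := [/\ is_subgroup U, compact U & open U].

Lemma compact_open_subgroup_nbhs U : compact_open_subgroup U -> nbhs 1 U.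
Proof. by move=> [[U1 _ _] _ oU]; exact: open_nbhs_nbhs. Qed.

Lemma compact_open_subgroupI U A : compact_open_subgroup U ->
  is_subgroup A -> open A -> compact_open_subgroup (U `&` A).
Proof.
move=> [sU kU oU] sA oA; split; [exact: subgroupI| |exact: openI].
by apply: compact_setI_closed => //; exact: open_subgroup_closed.
Qed.

Definition compact_subgroups_permute := forall A B,
  is_subgroup A -> compact A -> is_subgroup B -> compact B ->
  mulset A B = mulset B A.

Definition locally_elliptic := forall C, compact C ->
  exists2 U, compact_open_subgroup U & C `<=` U.

(** A product of two compact sets is compact, hence closed, so that the closures
    in the definition disappear. *)
Lemma quasihamiltonian_permute : hausdorff_space G ->
  topologically_quasihamiltonian G -> compact_subgroups_permute.
Proof.
move=> hG qG A B sA kA sB kB.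
have [_ _ /(_ B sB (compact_closed hG kB))] := qG A sA (compact_closed hG kA).
by rewrite -!(closure_id _).1//;
  apply: compact_closed => //; exact: compact_mulset.
Qed.

(** The product of permuting compact subgroups is a compact subgroup. *)
Lemma finite_sub_compact_subgroup F : compactly_covered G ->
  compact_subgroups_permute -> finite_set F ->
  exists K, [/\ is_subgroup K, compact K & F `<=` K].
Proof.
move=> ccG perm /finite_seqP[s ->]; elim: s => [|x s [K [sK kK Ks]]].
  by exists [set 1]; split=> //; [exact: subgroup_set1|exact: compact_set1].
have [L [sL kL Lx]] := ccG x; have [K1 _ _] := sK; have [L1 _ _] := sL.
exists (mulset L K); split.
- by apply: mulset_subgroup => //; exact: perm.
- exact: compact_mulset.
- move=> y /=; rewrite inE => /predU1P[->|ys].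
    exact: (@sub_mulsetl _ L K).
  by apply: (@sub_mulsetr _ L K) => //; exact: Ks.
Qed.

(** Let [D] be a compact symmetric neighborhood of the identity containing [C].
    Finitely many translates of [D] cover [D * D]; with a compact subgroup [K]
    containing the translating elements, [D * D] is included in [K * D], so
    right multiplication by [D] preserves the compact set [S := K * D]. The right
    stabilizer of [S] contains [D], is therefore open and closed, and lies in
    [S] because 1 does. *)
Lemma elliptic_of_compactly_covered : locally_compact [set: G] ->
  compactly_covered G -> compact_subgroups_permute -> locally_elliptic.
Proof.
move=> lcG ccG perm C kC.
have [V nV kV] : exists2 V : set G, nbhs 1 V & compact V.
  have [V nV [kV _]] := lcG 1 I.
  exists V => //; move: nV; rewrite /within /=; apply: filterS => x; exact.
pose D := (C `|` V) `|` (fun x : G => x^-1) @` (C `|` V).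
have kD : compact D.
  apply: compactU; first exact: compactU.
  by apply: compact_image; [exact: invg_continuous|exact: compactU].
have DV x : D x -> D x^-1.
  by move=> [Ax|[y Ay <-]]; [right; exists x|left; rewrite invgK].
have [F finF DF] := compact_finite_translates (compact_mulset kD kD) nV.
have [K [sK kK FK]] := finite_sub_compact_subgroup ccG perm finF.
have [K1 KM _] := sK.
have D1 : D 1 by left; right; exact: nbhs_singleton.
pose S := mulset K D.
have SD s d : S s -> D d -> S (s * d).
  move=> [k Kk [d' Dd' <-]] Dd.
  have [f /FK Kf [v Vv E]] : mulset F V (d' * d).
    by apply: DF; exists d' => //; exists d.
  exists (k * f); first exact: KM.
  by exists v; [left; right|rewrite -mulgA E mulgA].
pose U := [set x | forall s, S (s * x) <-> S s].
have sU : is_subgroup U.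
  split=> [s|x y Ux Uy s|x Ux s]; first by rewrite mulg1.
  - by rewrite mulgA; split=> [/Uy/Ux//|/Ux/Uy].
  - by rewrite -[X in _ <-> S X](mulgVK x) Ux.
have DU : D `<=` U.
  move=> d Dd s; split=> [/SD/(_ (DV _ Dd))|Ss]; last exact: SD.
  by rewrite mulgK.
have oU : open U.
  apply: open_subgroup_nbhs => //; apply: filterS nV => v Vv.
  by apply: DU; left; right.
exists U; last by move=> x Cx; apply: DU; left; left.
split=> //; apply: (@subclosed_compact _ _ S).
- exact: open_subgroup_closed.
- exact: compact_mulset.
- move=> x Ux; rewrite -[x]mul1g; apply/Ux.
  by exists 1 => //; exists 1 => //; rewrite mulg1.
Qed.

(** The subgroup [A] need not be compact, but each of its elements lies in a
    compact subgroup of [A]. *)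
Lemma permute_open_subgroup A U : compact_subgroups_permute ->
  locally_elliptic -> is_subgroup A -> open A -> compact_open_subgroup U ->
  mulset A U = mulset U A.
Proof.
move=> perm ell sA oA [sU kU oU].
have K_ x : exists K, [/\ is_subgroup K, compact K, K `<=` A & A x -> K x].
  have [K kK Kx] := ell _ (@compact_set1 _ x); exists (K `&` A).
  have [sKA kKA _] := compact_open_subgroupI kK sA oA.
  by split=> // Ax; split=> //; exact: Kx.
apply/seteqP; split=> [_ [a Aa [u Uu <-]]|_ [u Uu [a Aa <-]]].
  have [K [sK kK KA /(_ Aa) Ka]] := K_ a.
  have : mulset K U (a * u) by exists a => //; exists u.
  by rewrite (perm K U sK kK sU kU); apply: mulsetSS.
have [K [sK kK KA /(_ Aa) Ka]] := K_ a.
have : mulset U K (u * a) by exists u => //; exists a.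
by rewrite (perm U K sU kU sK kK); apply: mulsetSS.
Qed.

End topological_groups.

(** * Trajectories of compact open subgroups *)

(** For a compact open subgroup [U] of a group with permuting compact subgroups,
    this is the least subgroup [W] with [W = phi @^-1` (mulset W U)]. *)
Definition cotrajectory (G : topologicalGroupType) (phi : G -> G) (U : set G) :=
  \bigcup_n (iter n phi @^-1` trajectory phi U n).

Section trajectories.
Variables (G : topologicalGroupType) (phi : G -> G).
Hypotheses (phiM : {morph phi : x y / x * y}) (cphi : continuous phi).
Implicit Types A B : set G.

Lemma iter_continuous n : continuous (iter n phi).
Proof.
elim: n => [|n IHn] x; first exact: cvg_id.
by apply: (@continuous_comp _ _ _ (iter n phi) phi); [exact: IHn|exact: cphi].
Qed.

Lemma trajectory_compact A n : compact A -> compact (trajectory phi A n).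
Proof.
move=> kA; elim: n => [|n IHn]; first exact: compact_set1.
apply: compact_mulset => //; apply: compact_image => //.
exact: iter_continuous.
Qed.

Lemma trajectoryS A B n :
  A `<=` B -> trajectory phi A n `<=` trajectory phi B n.
Proof.
by move=> AB; elim: n => // n IHn; apply: mulsetSS => //; exact: image_subset.
Qed.

Lemma trajectory_incr A n :
  A 1 -> trajectory phi A n `<=` trajectory phi A n.+1.
Proof.
move=> A1; apply: sub_mulsetl; exists 1 => //.
by apply: morph_1; exact: iter_morph.
Qed.

Lemma sub_trajectory A n : A 1 -> A `<=` trajectory phi A n.+1.
Proof.
move=> A1; elim: n => [|n IHn]; last by move=> x /IHn; exact: trajectory_incr.
by move=> x Ax; exists 1 => //; exists x; [exists x|rewrite mul1g].
Qed.

Lemma image_trajectory A n : A 1 ->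
  phi @` trajectory phi A n `<=` trajectory phi A n.+1.
Proof.
move=> A1; elim: n => [|n IHn].
  by move=> _ [_ -> <-]; rewrite (morph_1 phiM); exact: sub_trajectory.
rewrite [X in phi @` X]/= image_mulset//; apply: mulsetSS => //.
by rewrite image_comp => _ [x Ax <-]; exists x.
Qed.

Section compact_open.
Variable U : set G.
Hypotheses (perm : compact_subgroups_permute G) (kU : compact_open_subgroup U).
Local Notation T := (trajectory phi U).
Local Notation W := (cotrajectory phi U).

Let U1 : U 1. Proof. by case: kU => -[]. Qed.

Lemma trajectory_subgroup n : is_subgroup (T n).
Proof.
have [sU cU _] := kU.
elim: n => [|n IHn]; first exact: subgroup_set1.
have sphi : is_subgroup (iter n phi @` U).
  by apply: image_subgroup => //; exact: iter_morph.
apply: mulset_subgroup => //; apply: perm => //.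
  exact: trajectory_compact.
by apply: compact_image => //; exact: iter_continuous.
Qed.

Lemma trajectory_open n : open (T n.+1).
Proof.
apply: open_subgroup_nbhs; first exact: trajectory_subgroup.
by apply: filterS (compact_open_subgroup_nbhs kU); exact: sub_trajectory.
Qed.

Lemma trajectory_compact_open n : compact_open_subgroup (T n.+1).
Proof.
split; [exact: trajectory_subgroup| |exact: trajectory_open].
by case: kU => _ cU _; exact: trajectory_compact.
Qed.

Let W_ n := iter n phi @^-1` T n.

(** The point phi^n(y) lies in T_n phi^n(U) exactly when [y] lies in
    phi^(-n)(T_n) U, whatever the kernel of [phi] is. *)
Lemma cotrajectory_step n :
  iter n.+1 phi @^-1` T n.+1 = phi @^-1` mulset (iter n phi @^-1` T n) U.
Proof.
have iM := iter_morph n phiM; have iV := morph_V iM.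
apply/seteqP; split=> x.
  rewrite /preimage /mkset iterSr => -[t Tt [_ [u Uu <-] tu]].
  exists (phi x * u^-1); last by exists u => //; rewrite mulgVK.
  by rewrite iM iV -tu mulgK.
move=> [w Ww [u Uu wu]]; rewrite /preimage /mkset iterSr -wu iM.
by exists (iter n phi w) => //; exists (iter n phi u) => //; exists u.
Qed.

Lemma cotrajectory_incr m n : (m <= n)%N ->
  iter m phi @^-1` T m `<=` iter n phi @^-1` T n.
Proof.
elim: n => [|n IHn]; first by rewrite leqn0 => /eqP->.
rewrite leq_eqVlt => /predU1P[-> //|/IHn mn] x /mn /= Wx.
by apply: image_trajectory => //; exists (iter n phi x).
Qed.

Lemma cotrajectory_fix : W = phi @^-1` mulset W U.
Proof.
apply/seteqP; split=> [x [n _ Wx]|x [w [n _ Ww] [u Uu wu]]].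
  have : W_ n.+1 x by exact: cotrajectory_incr Wx.
  rewrite /W_ cotrajectory_step => -[w Ww [u Uu wu]].
  by exists w; [exists n|exists u].
by exists n.+1 => //; rewrite cotrajectory_step; exists w => //; exists u.
Qed.

Lemma cotrajectory_subgroup : is_subgroup W.
Proof.
have sW n : is_subgroup (W_ n).
  by apply: preimage_subgroup; [exact: iter_morph|exact: trajectory_subgroup].
split=> [|x y [m _ Wx] [n _ Wy]|x [n _ Wx]].
- by exists 0%N.
- exists (maxn m n) => //; have [_ WM _] := sW (maxn m n); apply: WM.
    exact: cotrajectory_incr (leq_maxl m n) _ Wx.
  exact: cotrajectory_incr (leq_maxr m n) _ Wy.
- by exists n => //; have [_ _ WV] := sW n; exact: WV.
Qed.

Lemma cotrajectory_open : open W.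
Proof.
have -> : W = \bigcup_n W_ n.+1.
  apply/seteqP; split=> x [n _ Wx]; last by exists n.+1.
  by exists n => //; exact: cotrajectory_incr Wx.
apply: bigcup_open => n _; apply: open_comp; last exact: trajectory_open.
by move=> x _; exact: iter_continuous.
Qed.

Lemma cotrajectory_min N : is_subgroup N -> U `<=` N -> phi @^-1` N `<=` N ->
  W `<=` phi @^-1` N.
Proof.
move=> sN UN phiN; have [N1 NM _] := sN.
suff WN n : W_ n `<=` phi @^-1` N by move=> x [n _ /WN].
elim: n => [x Wx|n IHn].
  have -> : x = 1 by exact: Wx.
  by rewrite /preimage /mkset (morph_1 phiM).
rewrite /W_ cotrajectory_step; apply: preimage_subset.
by move=> _ [w /IHn/phiN Nw [u /UN Nu <-]]; exact: NM.
Qed.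

Lemma has_index_trajectory n m : has_index (T n.+1) (T n) m ->
  has_index U (iter n phi @^-1` T n) m.
Proof.
move=> /(has_index_mulset _ _ (trajectory_subgroup n)).1.
by apply: has_index_image; exact: iter_morph.
Qed.

(** The compact set [U `&` W] is covered by the increasing open subgroups
    phi^(-n)(T_n), hence by one of them. *)
Lemma cotrajectory_stabilizes : exists n0, forall n, (n0 <= n)%N ->
  U `&` W = U `&` (iter n phi @^-1` T n).
Proof.
have [_ kUW _] :=
  compact_open_subgroupI kU cotrajectory_subgroup cotrajectory_open.
have [||D _ UWD] := group_compact_cover kUW (I := nat) (D := setT)
    (f := fun n => W_ n.+1).
- move=> n _; apply: open_comp; last exact: trajectory_open.
  by move=> x _; exact: iter_continuous.
- by move=> x [_ [n _ Wx]]; exists n => //; exact: cotrajectory_incr Wx.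
(* The cover uses the preimages of T_(n+1) by phi^(n+1), since T_0 = {1} is
   not open. *)
exists (\max_(i <- enum_fset D) i).+1 => n Dn.
apply/seteqP; split=> x [Ux Wx]; split=> //; last by exists n.
have [i /= Di Wi] := UWD x (conj Ux Wx).
apply: cotrajectory_incr Wi; apply: leq_trans Dn.
by rewrite ltnS; apply: leq_bigmax_seq.
Qed.

(** The index of T_n in T_(n+1) exists by compactness, and equals the index of
    phi^(-n)(T_n) in [U], which is eventually that of [W]. *)
Lemma trajectory_index k : has_index U W k ->
  exists n0, forall n, (n0 <= n)%N ->
  has_index (T n.+1) (T n) k.
Proof.
move=> Uk; have [n0 stab] := cotrajectory_stabilizes.
exists n0.+1 => -[//|n] n0n.
have [_ kT _] := trajectory_compact_open n.+1.
have [m Tm] :=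
  has_index_compact kT (trajectory_subgroup n.+1) (trajectory_open n).
suff -> : k = m by [].
apply: has_index_uniq Uk _; apply: has_index_eq (has_index_trajectory Tm).
  by case: kU.
by rewrite -(stab n.+1)// ltnW.
Qed.

End compact_open.
End trajectories.

(** * Exponential growth rates *)

Section growth.
Local Open Scope ring_scope.
Local Open Scope ereal_scope.
Variable R : realType.

Lemma le_limn_esup (u v : nat -> \bar R) : (forall n, u n <= v n) ->
  limn_esup u <= limn_esup v.
Proof.
move=> uv; rewrite !limn_esup_lim; apply: lee_lim; try exact: is_cvg_esups.
apply: nearW => n; apply: ge_ereal_sup => _ [m /= nm <-].
by apply: le_ereal_sup_tmp; exists (v m) => //; exists m.
Qed.

Lemma cvg_lne_growth (u : nat -> \bar R) (k n0 : nat) :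
  (forall n, 0 < u n < +oo) ->
  (forall n, (n0 <= n)%N -> u n.+1 = k%:R%:E * u n) ->
  (fun n => lne (u n) * (n.+1%:R^-1)%:E) @ \oo --> (ln (k%:R : R))%:E.
Proof.
move=> u_pos uS.
pose v n := fine (u n).
have uE n : u n = (v n)%:E.
  by rewrite fineK// ge0_fin_numE; case/andP: (u_pos n) => // /ltW.
have v0 n : (0 < v n)%R by have := u_pos n; rewrite uE lte_fin => /andP[].
have vS n : (n0 <= n)%N -> v n.+1 = (k%:R * v n)%R.
  by move=> /uS; rewrite !uE -EFinM => -[].
have k0 : (0 < (k%:R : R))%R.
  by have := v0 n0.+1; rewrite vS// pmulr_lgt0.
have lnv m : ln (v (n0 + m)%N) = (ln (v n0) + m%:R * ln (k%:R : R))%R.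
  elim: m => [|m IHm]; first by rewrite addn0 mul0r addr0.
  rewrite addnS vS ?leq_addr// lnM ?posrE// IHm -natr1.
  by ring.
(* Beyond n0, ln (u n) / (n+1) equals ln k + c / (n+1) for this c. *)
pose c := (ln (v n0) - n0.+1%:R * ln (k%:R : R))%R.
have cvg_r : (fun n => (ln (k%:R : R) + c * harmonic n)%R) @ \oo
    --> ln (k%:R : R).
  rewrite -[X in _ --> X]addr0 -[in X in _ --> X](mulr0 c).
  apply: cvgD; first exact: cvg_cst.
  by apply: cvgM; [exact: cvg_cst|exact: cvg_harmonic].
have : EFin \o (fun n => (ln (k%:R : R) + c * harmonic n)%R) @ \oo
    --> (ln (k%:R : R))%:E by apply: cvg_comp cvg_r _.
apply: cvg_trans; apply: near_eq_cvg; near=> n.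
have n0n : (n0 <= n)%N by near: n; exists n0.
rewrite uE lne_EFin// -EFinM /= /harmonic/=.
rewrite -[in ln (v _)](subnKC n0n) lnv natrB//.
congr (_%:E); rewrite /c -!natr1.
have n1 : (n%:R + 1 != 0 :> R)%R by rewrite natr1 pnatr_eq0.
by field.
Unshelve. all: by end_near. Qed.

End growth.

(** * Haar measure and entropy along compact open subgroups *)

Section haar.
Variables (R : realType) (G : topologicalGroupType).
Hypotheses (hG : hausdorff_space G) (ell : locally_elliptic G).
Variable mu : {measure set (borel G) -> \bar R}%R.
Hypothesis haar_mu : right_haar_measure mu.
Implicit Types A B U : set G.

Lemma open_borel_measurable A : open A -> measurable (A : set (borel G)).
Proof. by move=> oA; exact: sub_sigma_algebra. Qed.

Lemma compact_borel_measurable A : compact A -> measurable (A : set (borel G)).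
Proof.
move=> /(compact_closed hG) cA; rewrite -[A]setCK; apply: measurableC.
by apply: open_borel_measurable; exact: closed_openC.
Qed.

Lemma haar_translate B (g : G) : open B -> mu (mulset B [set g]) = mu B.
Proof.
move=> oB; have [_ inv _ _ _] := haar_mu.
rewrite -(inv B g (open_borel_measurable oB)); congr (mu _).
apply/seteqP; split=> [_ [x Bx [_ -> <-]]|_ [x Bx <-]]; first by exists x.
by exists x => //; exists g.
Qed.

(** [A] is a disjoint union of [n] right translates of [B]. *)
Lemma haar_index A B n : is_subgroup A -> is_subgroup B -> open B -> B `<=` A ->
  has_index A B n -> mu A = (n%:R%:E * mu B)%E.
Proof.
move=> [_ AM AV] sB oB BA [c cA cP]; have [_ BM BV] := sB.
have /choice[r rP] : forall i : 'I_n, exists x, A x /\ c x = i.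
  by move=> i; have [x Ax] : (c @` A) i; [rewrite cA /=|exists x].
pose F (i : 'I_n) := mulset B [set r i].
have FE i x : F i x <-> A x /\ c x = i.
  have [Ar cr] := rP i; rewrite /F -cr.
  split=> [[b Bb [_ -> <-]]|[Ax /(cP _ _ Ax Ar) Bxr]].
    have Abr : A (b * r i) by apply: AM => //; exact: BA.
    by split=> //; apply/cP => //; rewrite mulgK.
  by exists (x * (r i)^-1) => //; exists (r i) => //; rewrite mulgVK.
have AF : A = \big[setU/set0]_(i < n) F i.
  rewrite -bigcup_seq; apply/seteqP; split=> [x Ax|x [i _ /FE[]]//].
  have cn : (c x < n)%N by have : `I_n (c x) by rewrite -cA; exists x.
  by exists (Ordinal cn); [exact: mem_index_enum|apply/FE].
rewrite [in LHS]AF measure_bigsetU_ord.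
- rewrite (eq_bigr (fun=> mu B)) => [|i _]; last exact: haar_translate.
  by rewrite sumr_const card_ord mule_natl.
- by move=> i; apply: open_borel_measurable; exact: open_mulset_set1.
- move=> i j _ _ [x [/FE[_ xi] /FE[_ xj]]]; apply: val_inj => /=.
  by rewrite -xi xj.
Qed.

(** If [U] were negligible, so would be every compact set, as it is covered by
    finitely many translates of [U]; inner regularity would make [G] negligible. *)
Lemma haar_compact_open_gt0 U : compact_open_subgroup U -> (0 < mu U < +oo)%E.
Proof.
move=> kU; have [sU cU oU] := kU; have [mu0 _ mufin _ muin] := haar_mu.
rewrite mufin// andbT lt0e measure_ge0 andbT; apply/eqP => muU0.
move/eqP: mu0; apply; rewrite muin; last exact: openT.
apply/eqP; rewrite eq_le; apply/andP; split.
  apply: ge_ereal_sup => _ [K [cK _] <-].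
  have [V kV KV] := ell cK; have [sV cV oV] := kV.
  have [sVU _ oVU] := compact_open_subgroupI kV sU oU.
  have [n VUn] := has_index_compact cV sVU oVU.
  apply: (@le_trans _ _ (mu V)).
    apply: le_measure; rewrite ?inE //; first exact: compact_borel_measurable.
    exact: open_borel_measurable.
  rewrite (haar_index sV sVU oVU _ VUn); last exact: subIsetl.
  suff -> : mu (V `&` U) = 0%E by rewrite mule0.
  apply/eqP; rewrite eq_le measure_ge0 andbT -muU0.
  apply: le_measure; rewrite ?inE; last exact: subIsetr.
    exact: open_borel_measurable.
  exact: open_borel_measurable.
apply: ereal_sup_ubound; exists set0; last exact: measure0.
by split=> //; exact: compact0.
Qed.

Section entropy.
Hypothesis perm : compact_subgroups_permute G.
Variable phi : G -> G.
Hypotheses (phiM : {morph phi : x y / x * y}) (cphi : continuous phi).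

Lemma cvg_entropy U k : compact_open_subgroup U ->
  has_index U (cotrajectory phi U) k ->
  ((fun n => lne (mu (trajectory phi U n.+1)) * (n.+1%:R^-1)%:E)%E @ \oo
     --> (ln (k%:R : R))%:E).
Proof.
move=> kU Uk; have [n0 Tk] := trajectory_index phiM cphi perm kU Uk.
apply: (@cvg_lne_growth _ _ _ n0) => n.
  by apply/haar_compact_open_gt0/trajectory_compact_open.
move=> n0n; apply: haar_index (Tk n.+1 _).
- exact: trajectory_subgroup.
- exact: trajectory_subgroup.
- exact: trajectory_open.
- by apply: trajectory_incr => //; case: kU => -[].
- exact: leqW.
Qed.

Lemma H_alg_compact_open U k : compact_open_subgroup U ->
  has_index U (cotrajectory phi U) k -> H_alg mu phi U = (ln k%:R)%:E.
Proof.
move=> kU Uk; have H := cvg_entropy kU Uk.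
have Hc : cvgn (fun n => lne (mu (trajectory phi U n.+1)) * (n.+1%:R^-1)%:E)%E.
  by apply/cvg_ex; eexists; exact: H.
by rewrite /H_alg is_cvg_limn_esupE//; exact/cvg_lim.
Qed.

Lemma has_index_cotrajectory U : compact_open_subgroup U ->
  exists2 k, (0 < k)%N & has_index U (cotrajectory phi U) k.
Proof.
move=> kU; have [[U1 _ _] cU _] := kU.
have [k Uk] := has_index_compact cU (cotrajectory_subgroup phiM cphi perm kU)
  (cotrajectory_open phiM cphi perm kU).
by exists k => //; exact: has_index_gt0 U1 Uk.
Qed.

Lemma le_H_alg A U : compact A -> compact_open_subgroup U -> A `<=` U ->
  (H_alg mu phi A <= H_alg mu phi U)%E.
Proof.
move=> kA kU AU; apply: le_limn_esup => n; apply: lee_wpmul2r.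
  by rewrite lee_fin invr_ge0.
rewrite lee_lne ?in_itv/= ?leey ?andbT ?measure_ge0//.
apply: le_measure; rewrite ?inE.
- apply: compact_borel_measurable.
  by apply: (@trajectory_compact _ phi cphi A n.+1).
- by apply: open_borel_measurable; exact: (trajectory_open phiM cphi perm kU n).
- exact: (@trajectoryS _ phi A U n.+1).
Qed.

(** With [h_alg_le] below, this expresses the entropy as the supremum of
    ln [U : U /\ W] over compact open subgroups [U]. *)
Lemma ln_index_le_h_alg U k : compact_open_subgroup U ->
  has_index U (cotrajectory phi U) k -> ((ln k%:R)%:E <= h_alg mu phi)%E.
Proof.
move=> kU Uk; rewrite -(H_alg_compact_open kU Uk); apply: ereal_sup_ubound.
by exists U => //; split; [case: kU|exact: compact_open_subgroup_nbhs].
Qed.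

Lemma h_alg_le (z : \bar R) : (forall U k, compact_open_subgroup U ->
    has_index U (cotrajectory phi U) k -> ((ln k%:R)%:E <= z)%E) ->
  (h_alg mu phi <= z)%E.
Proof.
move=> Hz; apply: ge_ereal_sup => _ [C [kC _] <-].
have [U kU CU] := ell kC; have [k _ Uk] := has_index_cotrajectory kU.
apply: le_trans (le_H_alg kC kU CU) _.
by rewrite (H_alg_compact_open kU Uk); exact: Hz Uk.
Qed.

(** Choose a compact open subgroup [U'] of [N] containing representatives of the
    cosets of [phi @^-1` N] in [N]. Then [phi @^-1` N] has the same index in [U']
    as in [N], and the cotrajectory of [U'] lies in [phi @^-1` N]. *)
Lemma ln_preimage_index_le_h_alg N q : is_subgroup N -> open N ->
  phi @^-1` N `<=` N -> has_index N (phi @^-1` N) q ->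
  ((ln q%:R)%:E <= h_alg mu phi)%E.
Proof.
move=> sN oN phiN Nq; have sphiN := preimage_subgroup phiM sN.
have [F [finF FN NF]] := has_index_transversal Nq.
have [K kK FK] := ell (finite_compact finF).
have kU := compact_open_subgroupI kK sN oN.
have NE : mulset (phi @^-1` N) (K `&` N) = N.
  apply/seteqP; split=> [_ [x /phiN Nx [y [_ Ny] <-]]|x /NF[w Nw [y Fy <-]]].
    by have [_ NM _] := sN; exact: NM.
  by exists w => //; exists y => //; split; [exact: FK|exact: FN].
have Uq : has_index (K `&` N) (phi @^-1` N) q.
  by apply/(has_index_mulset _ _ sphiN); rewrite NE.
have [k k0 Uk] := has_index_cotrajectory kU.
apply: le_trans (ln_index_le_h_alg kU Uk).
have qk : (q <= k)%N.
  apply: has_index_le Uk Uq _.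
  by apply: cotrajectory_min => //; exact: subIsetr.
have q0 : (0 < q)%N by apply: has_index_gt0 Nq; case: sN => N1 _ _; exact: N1.
by rewrite lee_fin ler_ln ?posrE ?ltr0n// ler_nat.
Qed.

End entropy.
End haar.

(** * Closed subgroups *)

Section closed_subgroup.
Variables (G : topologicalGroupType) (H : set G) (sgH : is_subgroup H).
Hypothesis cH : closed H.
Local Notation K := (subgroup_of sgH).
Implicit Types (A : set G) (B : set K).

Lemma subgroup_val_morph : {morph (val : K -> G) : x y / x * y}.
Proof. by []. Qed.

Lemma subgroup_val_inj : injective (val : K -> G).
Proof. exact: val_inj. Qed.

Lemma subgroup_valP (x : K) : H (val x).
Proof. exact: set_mem (valP x). Qed.

Lemma subgroup_val_onto x : H x -> exists y : K, val y = x.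
Proof. by move=> Hx; exists (exist _ x (mem_set Hx)). Qed.

Lemma image_preimage_val A : (val : K -> G) @` (val @^-1` A) = A `&` H.
Proof.
apply/seteqP; split=> [_ [x Ax <-]|x [Ax /subgroup_val_onto[y yx]]].
  by split=> //; exact: subgroup_valP.
by exists y; rewrite // /preimage /= yx.
Qed.

Lemma compact_preimage_val A : compact A -> compact (val @^-1` A : set K).
Proof.
move=> kA F FF FA; have kAH : compact (A `&` H).
  exact: compact_setI_closed.
have [|y [[Ax /subgroup_val_onto[x xy]] clx]] :=
    kAH ((val : K -> G) x @[x --> F]) _.
  suff : F (val @^-1` (A `&` H)) by [].
  by apply: filterS FA => x Ax; split=> //; exact: subgroup_valP.
rewrite -{y}xy in Ax clx.
exists x; split=> //= P B FP; rewrite nbhsE => -[_ [[V oV <-] Vx] VB].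
have [| |_ [[z Pz <-] Vy]] := clx (val @` P) V.
- suff : F (val @^-1` (val @` P)) by [].
  by apply: filterS FP => y Py; exists y.
- exact: open_nbhs_nbhs.
- by exists z; split=> //; exact: VB.
Qed.

Lemma subgroup_hausdorff : hausdorff_space G -> hausdorff_space K.
Proof.
move=> hG x y xy; apply: subgroup_val_inj; apply: hG => A B nA nB.
have [z [Az Bz]] :=
  xy _ _ (subgroup_val_continuous nA) (subgroup_val_continuous nB).
by exists (val z).
Qed.

Lemma preimage_val_compact_open U : compact_open_subgroup U ->
  compact_open_subgroup (val @^-1` U : set K).
Proof.
move=> [sU kU oU]; split.
- exact: (preimage_subgroup subgroup_val_morph).
- exact: compact_preimage_val.
- by apply: open_comp => // x _; exact: subgroup_val_continuous.
Qed.

Lemma subgroup_locally_elliptic : locally_elliptic G -> locally_elliptic K.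
Proof.
move=> ell C kC.
have [U kU CU] := ell _ (compact_image (@subgroup_val_continuous _ _ sgH) kC).
exists (val @^-1` U); first exact: preimage_val_compact_open.
by move=> x Cx; apply: CU; exists x.
Qed.

Lemma subgroup_permute :
  compact_subgroups_permute G -> compact_subgroups_permute K.
Proof.
move=> perm A B sA kA sB kB; have vM := subgroup_val_morph.
have : (val : K -> G) @` mulset A B = val @` mulset B A; last first.
  move=> AB; apply/funext => x.
  by rewrite -!(image_inj subgroup_val_inj) AB.
rewrite !(image_mulset vM); apply: perm.
- exact: (image_subgroup vM).
- exact: compact_image (@subgroup_val_continuous _ _ sgH) kA.
- exact: (image_subgroup vM).
- exact: compact_image (@subgroup_val_continuous _ _ sgH) kB.
Qed.

End closed_subgroup.

(** * Quotients *)

Section quotient.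
Variables (G : topologicalGroupType) (H : set G) (nH : is_normal_subgroup H).
Local Notation Q := (quotient_by nH).
Local Notation pi := (coset_pi nH).

Lemma coset_pi_morph : {morph pi : x y / x * y}.
Proof. exact: coset_piM. Qed.

Lemma coset_pi_eq1 x : pi x = 1 <-> H x.
Proof.
have [sH _] := nH; rewrite (_ : 1 = pi 1)// coset_piP mulg1.
exact: subgroup_inv.
Qed.

(** If the cosets of [x] and [y] differ, the open complement of [H] contains
    [x^-1 * y]; continuity separates the two cosets. *)
Lemma quotient_hausdorff : closed H -> hausdorff_space Q.
Proof.
move=> cH p q; rewrite -[p]coset_reprK -[q]coset_reprK.
move: (coset_repr p) (coset_repr q) => x y pq; apply/coset_piP.
apply: contrapT => nHxy.
have : nbhs (x^-1 * y) (~` H).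
  by apply: open_nbhs_nbhs; split=> //; exact: closed_openC.
have c : continuous (fun z : G * G => z.1^-1 * z.2).
  move=> z; apply: (@continuous_comp _ _ _ (fun z : G * G => (z.1^-1, z.2))
    (fun z : G * G => z.1 * z.2)); last exact: mulg_continuous.
  apply: cvg_pair => /=; last exact: cvg_snd.
  apply: (@continuous_comp _ _ _ fst (fun z : G => z^-1)); first exact: cvg_fst.
  exact: invg_continuous.
move=> /(c (x, y))[[V W] /= [nV nW] VW].
have nbhs_pi (z : G) A : nbhs z A -> nbhs (pi z) (pi @` A).
  rewrite !nbhsE => -[B [oB Bz] BA]; exists (pi @` B); last exact: image_subset.
  by split; [exact: coset_pi_open|exists z].
have [_ [[v Vv <-] [w Ww /coset_piP wv]]] :=
  pq _ _ (nbhs_pi _ _ nV) (nbhs_pi _ _ nW).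
have [sH _] := nH.
apply: (VW (v, w)) => //=; apply/subgroup_inv => //.
by rewrite invgM invgK.
Qed.

Lemma compact_open_subgroup_pi U : compact_open_subgroup U ->
  compact_open_subgroup (pi @` U).
Proof.
move=> [sU kU oU]; split.
- exact: (image_subgroup coset_pi_morph).
- exact: compact_image (@coset_pi_continuous _ _ nH) kU.
- exact: coset_pi_open.
Qed.

(** Cover [C] by finitely many translates of the open image of some compact open
    subgroup, and choose [U] containing this subgroup and lifts of the
    translating elements. *)
Lemma compact_sub_pi (C : set Q) : locally_elliptic G -> compact C ->
  exists2 U, compact_open_subgroup U & C `<=` pi @` U.
Proof.
move=> ell kC; have [U kU _] := ell _ (@compact0 G).
have [sU cU oU] := kU.
have [F finF CF] := compact_finite_translates kC
  (compact_open_subgroup_nbhs (compact_open_subgroup_pi kU)).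
have cF : compact (@coset_repr _ _ nH @` F).
  exact/finite_compact/finite_image.
have [V kV UFV] := ell _ (compactU cU cF).
exists V => //; have [[_ VM _] _ _] := kV.
move=> _ /CF[f Ff [_ [u Uu <-] <-]].
exists (coset_repr f * u); last by rewrite coset_piM coset_reprK.
by apply: VM; apply: UFV; [right; exists f|left].
Qed.

Lemma quotient_locally_elliptic : locally_elliptic G -> locally_elliptic Q.
Proof.
move=> ell C /(compact_sub_pi ell)[U kU CU].
by exists (pi @` U) => //; exact: compact_open_subgroup_pi.
Qed.

(** The full preimage of [A] is not compact in general, but its intersection with
    a compact open subgroup whose image contains [A] is. *)
Lemma compact_subgroup_lift (A : set Q) :
  closed H -> locally_elliptic G -> is_subgroup A -> compact A ->
  exists B, [/\ is_subgroup B, compact B & pi @` B = A].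
Proof.
move=> cH ell sA kA; have [U [sU kU oU] AU] := compact_sub_pi ell kA.
have cA : closed A by apply: compact_closed => //; exact: quotient_hausdorff.
exists (U `&` pi @^-1` A); split.
- by apply: subgroupI => //; exact: (preimage_subgroup coset_pi_morph).
- apply: compact_setI_closed => //; apply: preimage_closed => //.
  by move=> x _; exact: coset_pi_continuous.
- apply/seteqP; split=> [_ [x [_ Ax] <-] //|a Aa].
  have [u Uu ua] := AU _ Aa; exists u => //; split=> //.
  by rewrite /preimage /= ua.
Qed.

Lemma quotient_permute : closed H -> locally_elliptic G ->
  compact_subgroups_permute G -> compact_subgroups_permute Q.
Proof.
move=> cH ell perm A B sA kA sB kB.
have [A' [sA' kA' <-]] := compact_subgroup_lift cH ell sA kA.
have [B' [sB' kB' <-]] := compact_subgroup_lift cH ell sB kB.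
by rewrite -!(image_mulset coset_pi_morph) perm.
Qed.

End quotient.

(** * The addition theorem *)

Section addition.
Variables (R : realType) (G : topologicalGroupType).
Hypotheses (hG : hausdorff_space G) (ell : locally_elliptic G).
Hypothesis perm : compact_subgroups_permute G.
Variable phi : {multiplicative G -> G}.
Hypothesis cphi : continuous phi.
Variables (H : set G) (nH : is_normal_subgroup H).
Hypotheses (cH : closed H) (phiH : phi @` H = H).

Local Notation K := (subgroup_of (proj1 nH)).
Local Notation Q := (quotient_by nH).
Local Notation pi := (coset_pi nH).
Local Notation psi := (restrict_endo (sgH := proj1 nH) (image_eq_set_fun phiH)).
Local Notation phibar := (@quotient_endo G H nH phi).

Let phiM : {morph phi : x y / x * y} := gmulfM.
Let invH := image_eq_set_fun phiH.

Lemma restrict_endo_morph : {morph psi : x y / x * y}.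
Proof. by move=> x y; apply: val_inj; exact: phiM. Qed.

Lemma restrict_endo_continuous : continuous psi.
Proof.
apply: continuous_to_subgroup => x.
apply: (@continuous_comp _ _ _ (val : K -> G) phi); last exact: cphi.
exact: subgroup_val_continuous.
Qed.

Lemma quotient_endo_morph : {morph phibar : x y / x * y}.
Proof.
move=> p q; rewrite -[p]coset_reprK -[q]coset_reprK -coset_piM.
by rewrite !(quotient_endoE _ invH) phiM coset_piM.
Qed.

Lemma quotient_endo_continuous : continuous phibar.
Proof.
apply: continuous_from_quotient => x.
have -> : phibar \o pi = pi \o phi.
  by apply/funext => y; exact: (quotient_endoE nH invH).
by apply: continuous_comp; [exact: cphi|exact: coset_pi_continuous].
Qed.

Let psiM := restrict_endo_morph.
Let cpsi := restrict_endo_continuous.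
Let barM := quotient_endo_morph.
Let cbar := quotient_endo_continuous.

Lemma iter_quotient_endo n x : iter n phibar (pi x) = pi (iter n phi x).
Proof. by elim: n => //= n ->; exact: (quotient_endoE nH invH). Qed.

Lemma iter_restrict_endo n x : val (iter n psi x) = iter n phi (val x).
Proof. by elim: n => //= n <-. Qed.

Lemma trajectory_quotient (A : set G) n :
  trajectory phibar (pi @` A) n = pi @` trajectory phi A n.
Proof.
elim: n => [|n IHn]; first by rewrite /= image_set1.
rewrite [LHS]/= IHn [RHS](image_mulset (@coset_pi_morph _ _ nH)); congr mulset.
rewrite !image_comp; apply: eq_imagel => x _; exact: iter_quotient_endo.
Qed.

Lemma trajectory_restrict (A : set G) n :
  trajectory psi (val @^-1` A) n `<=` val @^-1` (trajectory phi A n).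
Proof.
elim: n => [_ ->//|n IHn _ [x /IHn Tx [_ [y Ay <-] <-]]].
exists (val x) => //; exists (iter n phi (val y)); first by exists (val y).
by rewrite -iter_restrict_endo.
Qed.

(** The inclusion from left to right needs [phi @` H = H]: if phi(x) = w u h with
    [h] in [H], write h = phi(h'); then phi(x h'^-1) = w u, and the coset of [x]
    is also that of x h'^-1. *)
Lemma cotrajectory_quotient (U : set G) :
  cotrajectory phibar (pi @` U) = pi @` cotrajectory phi U.
Proof.
have piM := @coset_pi_morph _ _ nH.
suff step n : iter n phibar @^-1` trajectory phibar (pi @` U) n =
    pi @` (iter n phi @^-1` trajectory phi U n).
  apply/seteqP; split=> [q [n _ Wq]|_ [x [n _ Wx] <-]].
    have : (pi @` (iter n phi @^-1` trajectory phi U n)) q by rewrite -step.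
    by move=> [x Wx <-]; exists x => //; exists n.
  exists n => //.
  have : (pi @` (iter n phi @^-1` trajectory phi U n)) (pi x) by exists x.
  by rewrite -step.
elim: n => [|n IHn].
  apply/seteqP; split=> [q q1|_ [x x1 <-]].
    by exists 1 => //; rewrite (morph_1 piM); apply/esym.
  have -> : x = 1 by exact: x1.
  by rewrite (morph_1 piM).
rewrite (cotrajectory_step barM) IHn (cotrajectory_step phiM).
apply/seteqP; split=> [q|_ [x [w Ww [u Uu wu]] <-]]; last first.
  rewrite /preimage /mkset (quotient_endoE nH invH) -wu piM.
  by exists (pi w); [exists w|exists (pi u) => //; exists u].
rewrite -[q]coset_reprK; move: (coset_repr q) => x.
rewrite /preimage /mkset (quotient_endoE nH invH).
move=> [_ [w Ww <-] [_ [u Uu <-]]]; rewrite -piM => /coset_piP.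
rewrite -[X in X _]phiH => -[h Hh hE].
exists (x * h^-1); last first.
  by apply/coset_piP; rewrite invgM invgK mulgVK.
exists w => //; exists u => //.
by rewrite phiM (morph_V phiM) hE invgM invgK mulVKg.
Qed.

Variable mu : {measure set (borel G) -> \bar R}%R.
Hypothesis haar_mu : right_haar_measure mu.
Variable nu : {measure set (borel K) -> \bar R}%R.
Hypothesis haar_nu : right_haar_measure nu.
Variable lambda : {measure set (borel Q) -> \bar R}%R.
Hypothesis haar_lambda : right_haar_measure lambda.

Let hK : hausdorff_space K := subgroup_hausdorff hG.
Let ellK : locally_elliptic K := subgroup_locally_elliptic cH ell.
Let permK : compact_subgroups_permute K := subgroup_permute perm.
Let hQ : hausdorff_space Q := quotient_hausdorff cH.
Let ellQ : locally_elliptic Q := quotient_locally_elliptic ell.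
Let permQ : compact_subgroups_permute Q := quotient_permute cH ell perm.

Let pi_kernel : pi @^-1` [set 1] = H.
Proof.
by apply/seteqP; split=> x; rewrite /preimage /mkset /= coset_pi_eq1.
Qed.

Lemma has_index_extension (A B : set G) n p q :
  is_subgroup A -> is_subgroup B ->
  B `<=` A -> has_index A B n -> has_index (pi @` A) (pi @` B) p ->
  has_index (A `&` H) B q -> n = (p * q)%N.
Proof.
move=> sA sB BA An Ap Aq; apply: has_index_uniq An _.
by apply: (has_index_mul (@coset_pi_morph _ _ nH)) => //; rewrite pi_kernel.
Qed.

Lemma has_index_val (A B : set G) n : has_index (A `&` H) B n ->
  has_index (val @^-1` A : set K) (val @^-1` B) n.
Proof.
by rewrite -(image_preimage_val (proj1 nH)); apply: has_index_image.
Qed.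

(** The index of [W] in [V := mulset W U] splits as [p * q]: [p] is the index
    giving the entropy of the induced map along [pi @` U], and [q] is the index of
    [psi @^-1` N] in [N], where [N] is the trace of [V] on [H]. *)
Lemma h_alg_le_add : (h_alg mu phi <= h_alg nu psi + h_alg lambda phibar)%E.
Proof.
apply: (h_alg_le hG ell haar_mu perm phiM cphi) => U k kU Uk.
have [sU _ _] := kU; have [U1 _ _] := sU.
set W := cotrajectory phi U in Uk.
have sW : is_subgroup W by exact: cotrajectory_subgroup.
have oW : open W by exact: cotrajectory_open.
pose V := mulset W U.
have sV : is_subgroup V.
  by apply: mulset_subgroup => //; exact: permute_open_subgroup.
have WV : W `<=` V by exact: sub_mulsetl.
have Vk : has_index V W k by apply/has_index_mulset.
have kpU := compact_open_subgroup_pi nH kU.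
have [p p0 Up] := has_index_cotrajectory permQ barM cbar kpU.
have Vp : has_index (pi @` V) (pi @` W) p.
  rewrite (image_mulset (@coset_pi_morph _ _ nH)) has_index_mulset.
    by rewrite -cotrajectory_quotient.
  by apply: image_subgroup => //; exact: coset_pi_morph.
have [q Vq] := has_index_sub sW Vk (@subIsetl _ V H).
rewrite (has_index_extension sV sW WV Vk Vp Vq).
have q0 : (0 < q)%N.
  apply: (@has_index_gt0 _ _ _ _ 1 _ Vq); split; first by apply: WV; case: sW.
  by case: nH => -[].
rewrite natrM lnM ?posrE ?ltr0n// EFinD addeC; apply: leeD; last first.
  exact: (ln_index_le_h_alg hQ ellQ haar_lambda permQ barM cbar kpU Up).
have vM := @subgroup_val_morph _ _ (proj1 nH).
have psiV : psi @^-1` (val @^-1` V) = val @^-1` W.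
  by rewrite /W cotrajectory_fix.
apply: (ln_preimage_index_le_h_alg hK ellK haar_nu permK psiM cpsi
  (N := val @^-1` V)).
- exact: (preimage_subgroup vM).
- apply: open_comp; last exact: open_mulset.
  by move=> x _; exact: subgroup_val_continuous.
- by rewrite psiV => x; exact: WV.
- by rewrite psiV; exact: has_index_val.
Qed.

(** Along [U], the growth ratio of the trajectory in [G] is [k2] times the growth
    ratio [q] of its trace on [H]. Since this trace contains the trajectory of the
    trace of [U], a comparison of the measures gives [k1 <= q]. *)
Lemma ln_index_add_le U k1 k2 : compact_open_subgroup U ->
  has_index (val @^-1` U : set K) (cotrajectory psi (val @^-1` U)) k1 ->
  has_index (pi @` U) (cotrajectory phibar (pi @` U)) k2 ->
  ((ln k1%:R)%:E + (ln k2%:R)%:E <= h_alg mu phi)%E.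
Proof.
move=> kU Uk1 Uk2.
have [[U1 _ _] _ _] := kU.
have kUK := preimage_val_compact_open (proj1 nH) cH kU.
have kUQ := compact_open_subgroup_pi nH kU.
have [k k0 Uk] := has_index_cotrajectory perm phiM cphi kU.
apply: le_trans (ln_index_le_h_alg hG ell haar_mu perm phiM cphi kU Uk).
have [n0 Tk] := trajectory_index phiM cphi perm kU Uk.
have [n2 Tk2] := trajectory_index barM cbar permQ kUQ Uk2.
have k20 : (0 < k2)%N.
  by apply: has_index_gt0 Uk2; exists 1.
pose T := trajectory phi U.
have sT m : is_subgroup (T m) by exact: trajectory_subgroup.
have step n : (maxn n0 n2 <= n)%N ->
    exists2 q, k = (k2 * q)%N & has_index (T n.+1 `&` H) (T n) q.
  rewrite geq_max => /andP[n0n n2n].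
  have [q Tq] := has_index_sub (sT n) (Tk _ n0n) (@subIsetl _ (T n.+1) H).
  exists q => //; apply: (has_index_extension (sT _) (sT _) _ (Tk _ n0n) _ Tq).
    exact: trajectory_incr.
  by have := Tk2 _ n2n; rewrite !trajectory_quotient.
have [q kE _] := step _ (leqnn _).
have Tq n : (maxn n0 n2 <= n)%N -> has_index (T n.+1 `&` H) (T n) q.
  by move=> /step[q']; rewrite kE => /eqP; rewrite eqn_pmul2l// => /eqP <-.
have q0 : (0 < q)%N by move: k0; rewrite kE muln_gt0 => /andP[].
rewrite kE natrM lnM ?posrE ?ltr0n// EFinD addeC leeD2r//.
have kTK n : compact_open_subgroup (val @^-1` T n.+1 : set K).
  by apply: preimage_val_compact_open => //; exact: trajectory_compact_open.
have cvgq : ((fun n => lne (nu (val @^-1` T n.+1 : set K)) *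
    (n.+1%:R^-1)%:E)%E @ \oo --> (ln (q%:R : R))%:E).
  apply: (@cvg_lne_growth _ _ _ (maxn n0 n2)) => n.
    exact: haar_compact_open_gt0.
  move=> n0n; have [sA _ _] := kTK n.+1; have [sB _ oB] := kTK n.
  apply: haar_index => //.
    by apply: preimage_subset; exact: trajectory_incr.
  by apply: has_index_val; apply: Tq; exact: leqW.
rewrite -(H_alg_compact_open hK ellK haar_nu permK psiM cpsi kUK Uk1).
rewrite -(cvg_lim _ cvgq)// -is_cvg_limn_esupE; last first.
  by apply/cvg_ex; eexists; exact: cvgq.
rewrite /H_alg; apply: le_limn_esup => n; apply: lee_wpmul2r.
  by rewrite lee_fin invr_ge0 ler0n.
rewrite lee_lne ?in_itv/= ?leey ?andbT ?measure_ge0//.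
apply: le_measure; rewrite ?inE.
- apply: open_borel_measurable.
  exact: (trajectory_open psiM cpsi permK kUK n).
- by apply: open_borel_measurable; case: (kTK n).
- exact: (@trajectory_restrict U n.+1).
Qed.

(** Given [U1] in [H] and [U2] in [G/H], some compact open subgroup of [G] has a
    trace on [H] containing [U1] and an image in [G/H] containing [U2]. *)
Lemma add_le_h_alg : (h_alg nu psi + h_alg lambda phibar <= h_alg mu phi)%E.
Proof.
have key : forall U1 k1 U2 k2,
    compact_open_subgroup U1 -> has_index U1 (cotrajectory psi U1) k1 ->
    compact_open_subgroup U2 -> has_index U2 (cotrajectory phibar U2) k2 ->
    ((ln k1%:R)%:E + (ln k2%:R)%:E <= h_alg mu phi)%E.
  move=> U1 k1 U2 k2 kU1 Uk1 kU2 Uk2.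
  have [_ cU1 _] := kU1; have [_ cU2 _] := kU2.
  have [V [_ cV _] U2V] := compact_sub_pi ell cU2.
  have [U kU VU] := ell (compactU cV
    (compact_image (@subgroup_val_continuous _ _ (proj1 nH)) cU1)).
  have kUK := preimage_val_compact_open (proj1 nH) cH kU.
  have kUQ := compact_open_subgroup_pi nH kU.
  have [m1 _ Um1] := has_index_cotrajectory permK psiM cpsi kUK.
  have [m2 _ Um2] := has_index_cotrajectory permQ barM cbar kUQ.
  apply: le_trans (ln_index_add_le kU Um1 Um2); apply: leeD.
    rewrite -(H_alg_compact_open hK ellK haar_nu permK psiM cpsi kU1 Uk1).
    rewrite -(H_alg_compact_open hK ellK haar_nu permK psiM cpsi kUK Um1).
    apply: (le_H_alg hK nu permK psiM cpsi cU1 kUK).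
    by move=> x Ux; apply: VU; right; exists x.
  rewrite -(H_alg_compact_open hQ ellQ haar_lambda permQ barM cbar kU2 Uk2).
  rewrite -(H_alg_compact_open hQ ellQ haar_lambda permQ barM cbar kUQ Um2).
  apply: (le_H_alg hQ lambda permQ barM cbar cU2 kUQ).
  by move=> q /U2V[x Vx <-]; exists x => //; apply: VU; left.
have [U2 kU2 _] := ellQ (@compact0 Q).
have [k2 k20 Uk2] := has_index_cotrajectory permQ barM cbar kU2.
have [U1 kU1 _] := ellK (@compact0 K).
have [k1 k10 Uk1] := has_index_cotrajectory permK psiM cpsi kU1.
have lnk_ge0 k : (0 < k)%N -> (0 <= (ln (k%:R : R))%:E)%E.
  by move=> k0; rewrite lee_fin ln_ge0// ler1n.
have hz : (0 <= h_alg mu phi)%E.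
  apply: le_trans (key _ _ _ _ kU1 Uk1 kU2 Uk2).
  by apply: adde_ge0; exact: lnk_ge0.
have [->|zfin] := eqVneq (h_alg mu phi) +oo%E; first exact: leey.
have hfin : h_alg mu phi \is a fin_num.
  by rewrite ge0_fin_numE// lt_neqAle zfin leey.
have h2 : forall U k, compact_open_subgroup U ->
    has_index U (cotrajectory psi U) k ->
    (h_alg lambda phibar <= h_alg mu phi - (ln k%:R)%:E)%E.
  move=> U k kU Uk.
  apply: (h_alg_le hQ ellQ haar_lambda permQ barM cbar) => V m kV Vm.
  by rewrite leeBrDl//; exact: (key _ _ _ _ kU Uk kV Vm).
have h2fin : h_alg lambda phibar \is a fin_num.
  rewrite ge0_fin_numE.
    by apply: le_lt_trans (h2 _ _ kU1 Uk1) _; rewrite ltey_eq fin_numB hfin.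
  apply: le_trans
    (ln_index_le_h_alg hQ ellQ haar_lambda permQ barM cbar kU2 Uk2).
  exact: lnk_ge0.
rewrite -leeBrDr//.
apply: (h_alg_le hK ellK haar_nu permK psiM cpsi) => U k kU Uk.
by rewrite leeBrDr// -leeBrDl//; exact: (h2 _ _ kU Uk).
Qed.

End addition.

Theorem theorem5p4 (R : realType) (G : topologicalGroupType)
    (hausG : hausdorff_space G)
    (lcG : locally_compact [set: G]%classic)
    (ccG : compactly_covered G)
    (qhG : topologically_quasihamiltonian G)
    (phi : {multiplicative G -> G})
    (cphi : continuous phi)
    (H : set G)
    (nH : is_normal_subgroup H)
    (cH : closed H)
    (phiH : (phi @` H)%classic = H)
    (kerH : (phi @^-1` [set 1%g] `<=` H)%classic)
    (mu : {measure set (borel G) -> \bar R}%R)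
    (haar_mu : right_haar_measure mu)
    (nu : {measure set (borel (subgroup_of (proj1 nH))) -> \bar R}%R)
    (haar_nu : right_haar_measure nu)
    (lambda : {measure set (borel (quotient_by nH)) -> \bar R}%R)
    (haar_lambda : right_haar_measure lambda) :
  (h_alg mu phi =
   h_alg nu (restrict_endo (image_eq_set_fun phiH)) +
   h_alg lambda (quotient_endo phi))%E.
Proof.
have perm := quasihamiltonian_permute hausG qhG.
have ell := elliptic_of_compactly_covered lcG ccG perm.
apply/eqP; rewrite eq_le; apply/andP; split.
  exact: h_alg_le_add.
exact: add_le_h_alg.
Qed.
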